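(* Let $n\ge1$, $\sigma=\{\sigma_1,\dots,\sigma_n\}$, and let $k$ be a $\sigma$-field. Let $M$ be a finitely $\sigma$-generated $\sigma$-$k$-module, presented with $s\ge1$ generators as $M\cong N/K$, where $N$ is the free $\sigma$-$k$-module with $\sigma$-basis $y_1,\dots,y_s$ and $K$ is a $\sigma$-$k$-submodule of $N$, and let $G$ be the corresponding $\sigma$-closed subgroup of $\mathbb{G}_a^s$, i.e. the one defined by the $\sigma$-Hopf ideal $(K)\subseteq k\{y_1,\dots,y_s\}=k\{\mathbb{G}_a^s\}$ generated by $K$. Then the dimension polynomial of the standard excellent filtration $(M_i)_{i\in\mathbb{Z}}$ of $M$ (with respect to this presentation) and the dimension polynomial of the Zariski closures $(G[i])_{i\in\mathbb{N}}$ of $G$ with respect to $\mathbb{G}_a^s$ are equal. Therefore, $M$ and $G$ have the same $\sigma$-dimension, $\sigma$-type and typical $\sigma$-dimension.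
   Context: All rings are commutative with unit except the ring $\mathcal{D}$ below; $\mathbb{N}=\{0,1,2,\dots\}$. A $\sigma$-field is a field $k$ with $n$ pairwise commuting ring endomorphisms $\sigma_1,\dots,\sigma_n$. $T_\sigma$ is the free commutative monoid of formal monomials $\tau=\sigma_1^{k_1}\cdots\sigma_n^{k_n}$, $\operatorname{ord}(\tau)=k_1+\dots+k_n$, $T_\sigma[i]=\{\tau\mid\operatorname{ord}(\tau)\le i\}$. Modules: $\mathcal{D}$ is the ring of $\sigma$-operators over $k$, i.e. finite sums $\sum_{\tau\in T_\sigma}a_\tau\tau$ with $a_\tau\in k$ and multiplication determined by $\tau a=\tau(a)\tau$ for $a\in k$. A $\sigma$-$k$-module is a $\mathcal{D}$-module, equivalently a $k$-vector space with pairwise commuting additive maps $\sigma_j$ satisfying $\sigma_j(rx)=\sigma_j(r)\sigma_j(x)$; it is finitely $\sigma$-generated if finitely generated over $\mathcal{D}$; the free $\sigma$-$k$-module with $\sigma$-basis $y_1,\dots,y_s$ is the free $\mathcal{D}$-module on $y_1,\dots,y_s$; it has $k$-basis $\{\tau(y_l)\mid\tau\in T_\sigma,1\le l\le s\}$ and is identified with the space of homogeneous linear $\sigma$-polynomials in $k\{y_1,\dots,y_s\}$. For $i\in\mathbb{N}$, $M_i$ is the $k$-subspace of $M$ spanned by the images of $\tau(y_l)$, $\tau\in T_\sigma[i]$, $1\le l\le s$, and $M_i=0$ for $i<0$; $(M_i)_{i\in\mathbb{Z}}$ is the standard excellent filtration. By a theorem of Levin there is a polynomial $\psi\in\mathbb{Q}[t]$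 of degree at most $n$ (the dimension polynomial) with $\psi(i)=\dim_k(M_i)$ for all large $i$; its degree and leading coefficient depend only on $M$. Groups: $k\{y_1,\dots,y_s\}$ is the polynomial ring over $k$ in the variables $\tau(y_l)$, $\tau\in T_\sigma$, $1\le l\le s$, with $\sigma_j$ extended from $k$ by $\sigma_j(\tau(y_l))=(\sigma_j\tau)(y_l)$; it is the coordinate ring $k\{\mathbb{G}_a^s\}$ of the $\sigma$-algebraic group $R\mapsto (R^s,+)$ on $k$-$\sigma$-algebras ($k$-algebras with commuting endomorphisms $\sigma_j$ compatible with those of $k$), with Hopf structure for which all $\tau(y_l)$ are primitive. A $\sigma$-Hopf ideal is a Hopf ideal closed under all $\sigma_j$; it defines a $\sigma$-closed subgroup $G$ with $G(R)$ the set of common zeros in $R^s$. Put $k[\mathbb{G}_a^s[i]]=k[\tau(y_l)\mid\tau\in T_\sigma[i],1\le l\le s]$. The $i$-th Zariski closure $G[i]$ of $G$ with respect to $\mathbb{G}_a^s$ is the algebraic group with coordinate ring $k[\mathbb{G}_a^s[i]]/(\mathbb{I}(G)\cap k[\mathbb{G}_a^s[i]])$, where $\mathbb{I}(G)=(K)$ is the defining ideal of $G$; its dimension is the Krull dimension of this ring. There is a polynomial $\phi\in\mathbb{Q}[t]$ of degree at most $n$ (the dimension polynomial) with $\phi(i)=\dim(G[i])$ for all large $i$; its degree and leading coefficient depend only on $G$. Invariants: writing a dimension polynomial as $\sum_{j=0}^dc_j\binom{t+j}{j}$ with $c_j\in\mathbb{Z}$, $c_d\ne0$, the $\sigma$-type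 (of $M$, resp. $G$) is $d$, the typical $\sigma$-dimension is $c_d$, and the $\sigma$-dimension is $c_d$ if $d=n$ and $0$ if $d<n$. *)

(* Defs.v *)
From HB Require Import structures.
From mathcomp Require Import all_boot all_order all_algebra ring_quotient.
From mathcomp Require Import finmap boolp monalg.

Set Implicit Arguments.
Unset Strict Implicit.
Unset Printing Implicit Defensive.

Import GRing.Theory Num.Theory.
Local Open Scope ring_scope.

(** [{malg R[{cmonom V}]}] is the polynomial ring over [R] in the variables
    [V], an arbitrary [choiceType]. *)
Notation polyring R V := {malg R%type[{cmonom V%type}]}.

Section Eval.
Context (V : choiceType) (S : comNzRingType).

Definition mvar {R : comNzRingType} (v : V) : polyring R V := << ucm v >>.

Definition meval (g : V -> S) (m : {cmonom V}) : S :=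
  \prod_(v <- finsupp m) g v ^+ m v.

Lemma mevalEw (g : V -> S) (m : {cmonom V}) (D : {fset V}) :
  (finsupp m `<=` D)%fset -> meval g m = \prod_(v <- D) g v ^+ m v.
Proof.
move=> le; rewrite [LHS](big_fset_incl _ le) // => v _.
by rewrite memNfinsupp => /eqP ->; rewrite expr0.
Qed.

Lemma meval_mmorphism (g : V -> S) : mmorphism (meval g).
Proof.
split=> [m1 m2|]; last by rewrite /meval mdom1 big_seq_fset0.
rewrite /meval mdomD -!/(meval g _).
rewrite (mevalEw g (fsubsetUl (finsupp m1) (finsupp m2))).
rewrite (mevalEw g (fsubsetUr (finsupp m1) (finsupp m2))).
by rewrite -big_split /=; apply: eq_bigr => v _; rewrite cmM exprD.
Qed.

HB.instance Definition _ (g : V -> S) :=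
  isMultiplicative.Build {cmonom V} S (meval g) (meval_mmorphism g).

Lemma mevalU (g : V -> S) v : meval g (ucm v) = g v.
Proof. by rewrite /meval mdomU big_seq_fset1 cmUU expr1. Qed.

Context (R : comNzRingType).

(** The ring morphism that is [f] on the coefficients and maps the variable
    [v] to [g v]. *)
Definition peval (f : {rmorphism R -> S}) (g : V -> S) : polyring R V -> S :=
  mmap f (meval g).

HB.instance Definition _ f g := GRing.RMorphism.on (peval f g).

Lemma pevalX (f : {rmorphism R -> S}) g v : peval f g (mvar v) = g v.
Proof. by rewrite /peval/= mmapU /= rmorph1 mul1r mevalU. Qed.

Lemma pevalC (f : {rmorphism R -> S}) g c : peval f g c%:MP = f c.
Proof. by rewrite /peval/= mmapC. Qed.

Lemma peval_linear (f : {rmorphism R -> S}) (g : V -> S) (h : {malg R[V]}) :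
  peval f g (mmap (@malgC {cmonom V} R) (fun v => mvar v) h) = mmap f g h.
Proof.
rewrite mmapE rmorph_sum mmapE; apply: eq_bigr => v _.
by rewrite (rmorphM (peval f g)); congr (_ * _); [apply: pevalC | apply: pevalX].
Qed.

Lemma peval_linearD (f : {rmorphism R -> S}) (g1 g2 : V -> S)
    (h : {malg R[V]}) (l := mmap (@malgC {cmonom V} R) (fun v => mvar v) h) :
  peval f (fun v => g1 v + g2 v) l = peval f g1 l + peval f g2 l.
Proof.
rewrite !peval_linear /mmap -big_split; apply: eq_bigr => v _.
by rewrite mulrDr.
Qed.

End Eval.

Record sigmaField (n : nat) := SigmaField {
  sfield :> fieldType;
  sfend : 'I_n -> {rmorphism sfield -> sfield};
  sfendC : forall i j a, sfend i (sfend j a) = sfend j (sfend i a)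
}.

(** A module over the ring of [sigma]-operators, given as a vector space with
    commuting semilinear maps. *)
Record sigmaModule (n : nat) (k : sigmaField n) := SigmaModule {
  smodule :> lmodType k;
  smact : 'I_n -> {additive smodule -> smodule};
  smactC : forall i j x, smact i (smact j x) = smact j (smact i x);
  smactZ : forall j a x, smact j (a *: x) = sfend k j a *: smact j x
}.

Record sigmaSubmodule (n : nat) (k : sigmaField n) (M : sigmaModule k) :=
  SigmaSubmodule {
  ssubmodule :> {pred M};
  ssub_closed : submod_closed ssubmodule;
  ssub_stable : forall j x, x \in ssubmodule -> smact M j x \in ssubmodule
}.

(** The commutative monoid [T_sigma], written multiplicatively, is
    [{cmonom 'I_n}], and the order of a monomial is [mdeg]; the pair
    [(tau, l)] stands for [tau (y_l)]. *)
Definition svar (n s : nat) : choiceType := ({cmonom 'I_n} * 'I_s)%type.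

Definition svord (n s : nat) (v : svar n s) : nat := mdeg v.1.

Definition svshift (n s : nat) (j : 'I_n) (v : svar n s) : svar n s :=
  (mmul (ucm j) v.1, v.2).

Lemma svshiftC (n s : nat) i j (v : svar n s) :
  svshift i (svshift j v) = svshift j (svshift i v).
Proof. by rewrite /svshift /= !mulmA [mmul (ucm i) _]mulmC. Qed.

Section FreeModule.
Context (n : nat) (k : sigmaField n) (s : nat).
Local Notation N := {malg k[svar n s]}.

Definition free_act (j : 'I_n) (f : N) : N :=
  \sum_(v <- msupp f) << sfend k j f@_v *g svshift j v >>.

Lemma free_actEw j (f : N) (D : {fset svar n s}) : (msupp f `<=` D)%fset ->
  free_act j f = \sum_(v <- D) << sfend k j f@_v *g svshift j v >>.
Proof.
move=> le; rewrite [LHS](big_fset_incl _ le) // => v _ /mcoeff_outdom ->.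
by rewrite rmorph0 monalgU0.
Qed.

Lemma free_act_zmod_morphism j : zmod_morphism (free_act j).
Proof.
move=> f g; have le := msuppB_le f g.
rewrite (free_actEw j le) (free_actEw j (fsubsetUl (msupp f) (msupp g))).
rewrite (free_actEw j (fsubsetUr (msupp f) (msupp g))) -sumrB.
by apply: eq_bigr => v _; rewrite -monalgUB -rmorphB -mcoeffB.
Qed.

HB.instance Definition _ j :=
  GRing.isZmodMorphism.Build N N (free_act j) (free_act_zmod_morphism j).

Lemma free_actU j a (v : svar n s) :
  free_act j << a *g v >> = << sfend k j a *g svshift j v >>.
Proof. by rewrite (free_actEw j msuppU_le) big_seq_fset1 mcoeffUU. Qed.

Lemma free_actZ j a (f : N) : free_act j (a *: f) = sfend k j a *: free_act j f.
Proof.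
rewrite (free_actEw j (msuppZ_le a f)) scaler_sumr; apply: eq_bigr => v _.
by apply/malgP => w; rewrite !(mcoeffZ, mcoeffU) rmorphM mulrnAr.
Qed.

Lemma free_actC i j (f : N) :
  free_act i (free_act j f) = free_act j (free_act i f).
Proof.
rewrite !(free_actEw _ (fsubset_refl (msupp f))) !raddf_sum.
apply: eq_bigr => v _.
by rewrite /= !free_actU svshiftC sfendC.
Qed.

(** The free [sigma]-[k]-module with [sigma]-basis [y_1, ..., y_s], as the
    [k]-vector space with basis the [tau (y_l)]. *)
Definition free_module : sigmaModule k :=
  @SigmaModule n k N (fun j => free_act j) free_actC free_actZ.

End FreeModule.

(** The isomorphism [N / K ~= M], as a surjective morphism of
    [sigma]-[k]-modules [N -> M] with kernel [K]. *)
Record presentation (n : nat) (k : sigmaField n) (M : sigmaModule k) (s : nat)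
    (K : sigmaSubmodule (free_module k s)) := Presentation {
  pres :> {linear free_module k s -> M};
  pres_act : forall j x, pres (smact (free_module k s) j x) = smact M j (pres x);
  pres_surj : forall y, exists x, pres x = y;
  pres_ker : forall x, x \in K <-> pres x = 0
}.

Section Dimension.
Context (k : fieldType) (V : lmodType k).

Definition lin_span (S : V -> Prop) (x : V) : Prop :=
  exists (r : nat) (a : 'I_r -> k) (b : 'I_r -> V),
    (forall i, S (b i)) /\ x = \sum_i a i *: b i.

(** [b_1, ..., b_d] is a basis of the subspace [U]. *)
Definition has_dim (U : V -> Prop) (d : nat) : Prop :=
  exists b : 'I_d -> V,
    (forall a : 'I_d -> k, \sum_i a i *: b i = 0 -> forall i, a i = 0) /\
    (forall x, U x <-> exists a : 'I_d -> k, x = \sum_i a i *: b i).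

End Dimension.

(** [M_i]; it is zero for negative [i], as there is then no generator. *)
Definition std_filtration (n : nat) (k : sigmaField n) (M : sigmaModule k)
    (s : nat) (K : sigmaSubmodule (free_module k s)) (pi : presentation M K)
    (i : int) : M -> Prop :=
  lin_span (fun x => exists v : svar n s,
    (svord v)%:Z <= i /\ x = pi (<< v >> : {malg k[svar n s]})).

Section Ideals.
Context (A : comNzRingType).

Definition is_ideal (J : A -> Prop) : Prop :=
  J 0 /\ forall a x y, J x -> J y -> J (a * x + y).

Lemma is_idealD J x y : is_ideal J -> J x -> J y -> J (x + y).
Proof. by move=> [_ JD] Jx Jy; rewrite -[x]mul1r; apply: JD. Qed.

Lemma is_idealN J x : is_ideal J -> J x -> J (- x).
Proof. by move=> [J0 JD] Jx; rewrite -[- x]addr0 -mulN1r; apply: JD. Qed.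

Definition ideal_gen (S : A -> Prop) (x : A) : Prop :=
  forall J, is_ideal J -> (forall y, S y -> J y) -> J x.

Lemma ideal_gen_ideal S : is_ideal (ideal_gen S).
Proof.
split=> [J [] //|a x y Sx Sy J Jid SJ].
by apply: (proj2 Jid); [apply: Sx | apply: Sy].
Qed.

Lemma ideal_gen_sub (S : A -> Prop) x : S x -> ideal_gen S x.
Proof. by move=> Sx J _; apply. Qed.

Definition prime_chain (d : nat) (P : 'I_d.+1 -> prime_idealr A) : Prop :=
  forall i j : 'I_d.+1, (i < j)%N ->
    {subset P i <= P j} /\ ~ {subset P j <= P i}.

Definition krull_dim (d : nat) : Prop :=
  (exists P : 'I_d.+1 -> prime_idealr A, prime_chain P) /\
  (forall e (P : 'I_e.+1 -> prime_idealr A), prime_chain P -> (e <= d)%N).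

End Ideals.

Lemma ideal_preim (A B : comNzRingType) (f : {rmorphism A -> B}) J :
  is_ideal J -> is_ideal (fun x => J (f x)).
Proof.
move=> [J0 JD]; split=> [|a x y Jx Jy]; first by rewrite rmorph0.
by rewrite rmorphD rmorphM; apply: JD.
Qed.

Section SigmaPolynomials.
Context (n : nat) (k : sigmaField n) (s : nat).

(** [k{y_1, ..., y_s}] *)
Definition spoly : comNzRingType := polyring k (svar n s).

Definition spoly_act (j : 'I_n) : spoly -> spoly :=
  peval (@malgC {cmonom svar n s} k \o sfend k j) (fun v => mvar (svshift j v)).

(** [k{y} (x)_k k{y}], as the polynomial ring in two copies of the variables:
    [inl v] is [v (x) 1] and [inr v] is [1 (x) v]. *)
Definition spoly2 : comNzRingType := polyring k (svar n s + svar n s).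

Definition tensl : spoly -> spoly2 :=
  peval (@malgC {cmonom (svar n s + svar n s)%type} k) (fun v => mvar (inl v)).

Definition tensr : spoly -> spoly2 :=
  peval (@malgC {cmonom (svar n s + svar n s)%type} k) (fun v => mvar (inr v)).

(** The Hopf algebra structure for which all variables are primitive. *)
Definition comul : spoly -> spoly2 :=
  peval (@malgC {cmonom (svar n s + svar n s)%type} k)
    (fun v => mvar (inl v) + mvar (inr v)).

Definition counit : spoly -> k :=
  peval (idfun : {rmorphism k -> k}) (fun _ => 0).

Definition antipode : spoly -> spoly :=
  peval (@malgC {cmonom svar n s} k) (fun v => - mvar v).

HB.instance Definition _ j := GRing.RMorphism.on (spoly_act j).
HB.instance Definition _ := GRing.RMorphism.on tensl.
HB.instance Definition _ := GRing.RMorphism.on tensr.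
HB.instance Definition _ := GRing.RMorphism.on comul.
HB.instance Definition _ := GRing.RMorphism.on counit.
HB.instance Definition _ := GRing.RMorphism.on antipode.

(** A [sigma]-closed subgroup of [G_a^s], encoded by its defining
    [sigma]-Hopf ideal; [I (x) k{y} + k{y} (x) I] is the ideal generated by
    the two images of [I]. *)
Record sigmaSubgroup := SigmaSubgroup {
  sgideal :> {pred spoly};
  sg_ideal : is_ideal (fun f => f \in sgideal);
  sg_act : forall j f, f \in sgideal -> spoly_act j f \in sgideal;
  sg_comul : forall f, f \in sgideal ->
    ideal_gen (fun h => exists2 g, g \in sgideal & h = tensl g \/ h = tensr g)
      (comul f);
  sg_counit : forall f, f \in sgideal -> counit f = 0;
  sg_antipode : forall f, f \in sgideal -> antipode f \in sgideal
}.

(** [k[G_a^s[i]]], the subring of the [sigma]-polynomials in the variables of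
    order at most [i]. *)
Definition ord_le (i : nat) : {pred spoly} := fun f : polyring k (svar n s) =>
  all (fun m : {cmonom svar n s} =>
    all (fun v => svord v <= i)%N (finsupp m)) (msupp f).

Lemma ord_leP i (f : polyring k (svar n s)) :
  reflect (forall m v, m \in msupp f -> v \in finsupp m -> (svord v <= i)%N)
    ((f : spoly) \in ord_le i).
Proof.
apply: (iffP allP) => [H m v /H/allP|H m mf]; first exact.
by apply/allP => v; apply: H mf.
Qed.

Lemma ord_le_subring i : subring_closed (ord_le i).
Proof.
split=> [|f g /ord_leP Hf /ord_leP Hg|f g /ord_leP Hf /ord_leP Hg];
    apply/ord_leP => m v.
- by rewrite msuppU1 => /fset1P ->; rewrite mdom1.
- by move=> /(fsubsetP (msuppB_le f g)) /fsetUP[]; [apply: Hf | apply: Hg].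
- move=> /(fsubsetP (msuppM_incl _ _))/imfset2P[/= m1 m1f [m2 m2g ->]].
  by rewrite mdomD => /fsetUP[]; [apply: Hf | apply: Hg].
Qed.

HB.instance Definition _ i :=
  GRing.isSubringClosed.Build spoly (ord_le i) (ord_le_subring i).

Record opoly (i : nat) := OPoly {
  opval :> spoly;
  opvalP : opval \in ord_le i
}.

HB.instance Definition _ i := [isSub for @opval i].
HB.instance Definition _ i := [Choice of opoly i by <:].
HB.instance Definition _ i := [SubChoice_isSubComNzRing of opoly i by <:].

(** [I(G) :&: k[G_a^s[i]]] *)
Definition zcl_ideal (G : sigmaSubgroup) (i : nat) : {pred opoly i} :=
  [pred f | opval f \in G].
Arguments zcl_ideal : clear implicits.

Lemma zcl_ideal_closed G i : idealr_closed (zcl_ideal G i).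
Proof.
have [G0 GD] := sg_ideal G.
split=> [||a x y xG yG]; rewrite inE ?rmorph0 //=.
- apply/negP => /sg_counit; rewrite rmorph1 => /eqP.
  by rewrite oner_eq0.
- by apply: GD.
Qed.

HB.instance Definition _ G i :=
  isIdealr.Build (opoly i) (zcl_ideal G i) (zcl_ideal_closed G i).

(** The coordinate ring of [G[i]]. *)
Definition zcl_ring (G : sigmaSubgroup) (i : nat) : comNzRingType :=
  {ideal_quot (zcl_ideal G i)}.

End SigmaPolynomials.

Arguments spoly_act {n k s} j.
Arguments tensl {n k s}.
Arguments tensr {n k s}.
Arguments comul {n k s}.
Arguments counit {n k s}.
Arguments antipode {n k s}.

Section GroupOfModule.
Context (n : nat) (k : sigmaField n) (s : nat).
Local Notation N := (free_module k s).

(** The identification of the free [sigma]-[k]-module with the homogeneous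
    linear [sigma]-polynomials. *)
Definition lin_spoly (f : N) : spoly k s :=
  mmap (@malgC {cmonom svar n s} k) (fun v => mvar v) f.

Lemma lin_spoly_zmod_morphism : zmod_morphism lin_spoly.
Proof. exact: mmap_is_additive. Qed.

HB.instance Definition _ :=
  GRing.isZmodMorphism.Build N (spoly k s) lin_spoly lin_spoly_zmod_morphism.

Lemma peval_lin (S : comNzRingType) (e : {rmorphism k -> S}) g (f : N) :
  peval e g (lin_spoly f) = mmap e g f.
Proof. exact: peval_linear. Qed.

Lemma spoly_act_lin j (f : N) :
  spoly_act j (lin_spoly f) = lin_spoly (smact N j f).
Proof.
rewrite /spoly_act peval_lin mmapE /= /free_act raddf_sum; apply: eq_bigr => v _.
by rewrite /= /lin_spoly mmapU.
Qed.

Lemma antipode_lin (f : N) : antipode (lin_spoly f) = - lin_spoly f.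
Proof.
rewrite /antipode peval_lin /lin_spoly !mmapE -sumrN; apply: eq_bigr => v _.
by rewrite mulrN.
Qed.

Lemma counit_lin (f : N) : counit (lin_spoly f) = 0.
Proof. by rewrite /counit peval_lin mmapE big1 // => v _; rewrite mulr0. Qed.

Lemma comul_lin (f : N) :
  comul (lin_spoly f) = tensl (lin_spoly f) + tensr (lin_spoly f).
Proof.
exact: peval_linearD.
Qed.

Context (K : sigmaSubmodule N).

(** The ideal [(K)]. *)
Definition group_ideal : {pred spoly k s} := fun f =>
  `[< ideal_gen (fun g => exists2 h, h \in K & g = lin_spoly h) f >].

Lemma group_ideal_ideal : is_ideal (fun f => f \in group_ideal).
Proof.
have [J0 JD] := ideal_gen_ideal
  (fun g : spoly k s => exists2 h, h \in K & g = lin_spoly h).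
by split=> [|a x y /asboolP Jx /asboolP Jy]; apply/asboolP => //; apply: JD.
Qed.

Lemma group_ideal_lin h : h \in K -> lin_spoly h \in group_ideal.
Proof. by move=> Kh; apply/asboolP; apply: ideal_gen_sub; exists h. Qed.

Lemma group_ideal_ind (J : spoly k s -> Prop) : is_ideal J ->
  (forall h, h \in K -> J (lin_spoly h)) -> forall f, f \in group_ideal -> J f.
Proof. by move=> Jid KJ f /asboolP; apply=> // g [h Kh ->]; apply: KJ. Qed.

Lemma group_ideal_act j f : f \in group_ideal -> spoly_act j f \in group_ideal.
Proof.
move: f; apply: group_ideal_ind => [|h Kh].
  exact: (ideal_preim (spoly_act j) group_ideal_ideal).
by rewrite spoly_act_lin; apply/group_ideal_lin/ssub_stable.
Qed.

Lemma group_ideal_comul f : f \in group_ideal ->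
  ideal_gen (fun h =>
      exists2 g, g \in group_ideal & h = tensl g \/ h = tensr g)
    (comul f).
Proof.
move: f; apply: group_ideal_ind => [|h Kh].
  exact/ideal_preim/ideal_gen_ideal.
rewrite comul_lin; apply: (is_idealD (ideal_gen_ideal _)).
- by apply: ideal_gen_sub; exists (lin_spoly h); [apply: group_ideal_lin | left].
- by apply: ideal_gen_sub; exists (lin_spoly h); [apply: group_ideal_lin | right].
Qed.

Lemma group_ideal_counit f : f \in group_ideal -> counit f = 0.
Proof.
move: f; apply: group_ideal_ind => [|h _]; last exact: counit_lin.
by split=> [|a x y x0 y0]; rewrite ?rmorph0 // rmorphD rmorphM /= x0 y0 mulr0 addr0.
Qed.

Lemma group_ideal_antipode f : f \in group_ideal -> antipode f \in group_ideal.
Proof.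
move: f; apply: group_ideal_ind => [|h Kh].
  exact: (ideal_preim antipode group_ideal_ideal).
rewrite antipode_lin.
exact: (is_idealN group_ideal_ideal (group_ideal_lin Kh)).
Qed.

(** The [sigma]-closed subgroup of [G_a^s] defined by [(K)]. *)
Definition group_of : sigmaSubgroup k s :=
  SigmaSubgroup group_ideal_ideal group_ideal_act group_ideal_comul
    group_ideal_counit group_ideal_antipode.

End GroupOfModule.

(** [psi] has degree at most [n], and [psi i] is the [d] with [dim i d], for
    all large [i]. *)
Definition is_dim_poly (n : nat) (dim : nat -> nat -> Prop)
    (psi : {poly rat}) : Prop :=
  (size psi <= n.+1)%N /\
  exists i0 : nat, forall i : nat, (i0 <= i)%N ->
    exists2 d : nat, dim i d & psi.[i%:R] = d%:R.

(** The polynomial [binom(t + j, j)]. *)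
Definition binom_poly (j : nat) : {poly rat} :=
  (j`!%:R)^-1 *: \prod_(m < j) ('X + m.+1%:R%:P).

Definition binom_expansion (psi : {poly rat}) (d : nat) (c : nat -> int) :=
  psi = \sum_(j < d.+1) (c j)%:~R *: binom_poly j /\ c d != 0.

Definition poly_type (psi : {poly rat}) (d : nat) : Prop :=
  exists c, binom_expansion psi d c.

Definition poly_typical_dim (psi : {poly rat}) (e : int) : Prop :=
  exists d c, binom_expansion psi d c /\ e = c d.

(** The zero polynomial has no leading coefficient, hence neither a type nor a
    typical dimension; its [sigma]-dimension is [0] by convention. *)
Definition poly_sigma_dim (n : nat) (psi : {poly rat}) (e : int) : Prop :=
  (psi = 0 /\ e = 0) \/
  exists d c, binom_expansion psi d c /\
    ((d = n /\ e = c d) \/ ((d < n)%N /\ e = 0)).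

Section Invariants.
Context (n : nat) (k : sigmaField n) (s : nat).

Section Module.
Context (M : sigmaModule k) (K : sigmaSubmodule (free_module k s)).
Context (pi : presentation M K).

Definition module_dim_poly : {poly rat} -> Prop :=
  is_dim_poly n (fun i => has_dim (std_filtration pi i%:Z)).

Definition module_sigma_type (d : nat) : Prop :=
  exists2 psi, module_dim_poly psi & poly_type psi d.

Definition module_typical_dim (e : int) : Prop :=
  exists2 psi, module_dim_poly psi & poly_typical_dim psi e.

Definition module_sigma_dim (e : int) : Prop :=
  exists2 psi, module_dim_poly psi & poly_sigma_dim n psi e.

End Module.

Section Group.
Context (G : sigmaSubgroup k s).

Definition group_dim_poly : {poly rat} -> Prop :=
  is_dim_poly n (fun i => krull_dim (zcl_ring G i)).

Definition group_sigma_type (d : nat) : Prop :=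
  exists2 phi, group_dim_poly phi & poly_type phi d.

Definition group_typical_dim (e : int) : Prop :=
  exists2 phi, group_dim_poly phi & poly_typical_dim phi e.

Definition group_sigma_dim (e : int) : Prop :=
  exists2 phi, group_dim_poly phi & poly_sigma_dim n phi e.

End Group.
End Invariants.

(* Main.v *)
Require Import Defs.
From HB Require Import structures.
From mathcomp Require Import all_boot all_order all_algebra ring_quotient.
From mathcomp Require mpoly.
From mathcomp Require Import finmap boolp monalg.

Set Implicit Arguments.
Unset Strict Implicit.
Unset Printing Implicit Defensive.

Import GRing.Theory Num.Theory.
Local Open Scope ring_scope.
Local Open Scope quotient_scope.

(** The two dimension polynomials agree because their values agree in every
    order [i]: if [M_i] has dimension [d] over [k], then the coordinate ring
    of [G[i]] is a polynomial ring in [d] variables over [k], so its Krull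
    dimension is [d].

    The point is that [(K)] meets [k[G_a^s[i]]] only in the ideal generated by
    the elements of [K] of order at most [i].  In dual form: a [k]-algebra map
    on [k[G_a^s[i]]] that sends the linear forms in [K] of order at most [i]
    to zero sends all of [(K) :&: k[G_a^s[i]]] to zero
    ([group_ideal_peval]).  An element of [(K)] involves finitely many
    elements of [K], hence finitely many further variables, and values for
    these can be chosen one at a time so that the linear relations in [K] stay
    satisfied ([vanishes_extend1]); the extended map kills [(K)].

    Fix a basis [b_1, ..., b_d] of [M_i] and lifts [h_l] of the [b_l] to
    linear forms of order at most [i].  The classes of the [h_l] generate the
    coordinate ring of [G[i]], as each variable is congruent modulo [K] to a
    combination of them ([zcl_generates]), and they may be sent to
    arbitrary values in any [k]-algebra, by sending each variable to the
    corresponding combination of these values ([zcl_map_exists]).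

    The Krull dimension is then computed directly.  Sending the [h_l] to
    independent variables [X_l] and setting the first [j] of these to zero
    gives a strictly increasing chain of [d + 1] primes
    ([prime_chain_exists]).  Conversely, elements [x_j] taken in the
    successive differences of a chain of primes are algebraically independent
    ([chain_algebraically_free]), while counting monomials shows that an
    algebra generated by [d] elements contains no more than [d] algebraically
    independent ones ([prime_chain_le]).

    Finally each [M_i] is finite dimensional, so a Krull dimension conversely
    determines the dimension of [M_i], and a polynomial is determined by its
    values at large integers. *)

(** * Chains of primes in finitely generated algebras: the upper bound *)

Section KrullUpperBound.
Context (k : fieldType) (A : comNzRingType) (e : {rmorphism k -> A}).

(** Elements [x_j] in the successive differences of a chain of primes satisfy
    no polynomial relation, even modulo the smallest prime: dividing a
    relation by the largest power of [x_0] common to its monomials, which is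
    legitimate as [x_0] is not in the prime [P 0], and then reducing modulo
    [P 1], which contains [x_0], leaves a nontrivial relation between the
    remaining [x_j].  The exponents [a i] need only separate the indices of
    nonzero coefficients, so that dropping monomials amounts to replacing
    coefficients by zero. *)
Lemma chain_algebraically_free (I : finType) (P : nat -> prime_idealr A)
    (m : nat) (x : nat -> A) (a : I -> nat -> nat) (c : I -> k) :
  (forall j, (j < m)%N -> {subset P j <= P j.+1}) ->
  (forall j, (j < m)%N -> x j \in P j.+1) ->
  (forall j, (j < m)%N -> x j \notin P j) ->
  (forall i i', c i != 0 -> c i' != 0 ->
     (forall j, (j < m)%N -> a i j = a i' j) -> i = i') ->
  \sum_i e (c i) * \prod_(j < m) x j ^+ a i j \in P 0%N ->
  forall i, c i = 0.
Proof.
elim: m P x a c => [|m IHm] P x a c subP xP xNP a_inj sumP i.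
  apply/eqP; apply: contraT => ci_neq0; move: sumP.
  rewrite (bigD1 i) //= big_ord0 mulr1 big1 ?addr0 => [|i' ne].
    move=> /(idealMr (e (c i)^-1)).
    by rewrite -rmorphM mulVf // rmorph1 idealr1.
  rewrite big_ord0 mulr1; apply/eqP; rewrite fmorph_eq0.
  by apply: contraNT ne => ci'; apply/eqP/a_inj.
apply/eqP; apply: contraT => ci_neq0.
(* [a i0 0] is the power of [x 0] to divide by; [b] is what survives modulo
   [P 1]. *)
pose i0 := [arg min_(i' < i | c i' != 0) a i' 0%N].
have [ci0 min_i0] : c i0 != 0 /\ forall i', c i' != 0 -> (a i0 0 <= a i' 0)%N.
  by rewrite /i0; case: arg_minnP.
pose Y i' := \prod_(j < m) x j.+1 ^+ a i' j.+1.
pose b i' := if a i' 0%N == a i0 0%N then c i' else 0.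
suff /(_ i0) : forall i', b i' = 0 by rewrite /b eqxx; move/eqP: ci0.
have factorP :
    \sum_i' e (c i') * (x 0%N ^+ (a i' 0%N - a i0 0%N) * Y i') \in P 0%N.
  have : x 0%N ^+ a i0 0%N \notin P 0%N.
    elim: (a i0 0%N) => [|r IHr]; first by rewrite expr0 idealr1.
    by rewrite exprS prime_idealrM negb_or xNP.
  apply: contraNT => /negPf sumNP; move: sumP.
  rewrite (eq_bigr (fun i' => x 0%N ^+ a i0 0%N *
      (e (c i') * (x 0%N ^+ (a i' 0%N - a i0 0%N) * Y i')))) => [|i' _].
    by rewrite -mulr_sumr prime_idealrM sumNP orbF.
  have [->|ci'] := eqVneq (c i') 0; first by rewrite rmorph0 !mul0r mulr0.
  rewrite mulrCA [X in e _ * X = _]big_ord_recl; congr (_ * _).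
  by rewrite mulrA -exprD subnKC ?min_i0.
apply: (IHm (fun j => P j.+1) (fun j => x j.+1) (fun i' j => a i' j.+1)) => //.
- by move=> j; apply: (subP j.+1).
- by move=> j; apply: (xP j.+1).
- by move=> j; apply: (xNP j.+1).
- move=> i1 i2; rewrite /b.
  case: (a i1 0%N =P _) => [a1|_]; last by rewrite eqxx.
  case: (a i2 0%N =P _) => [a2|_]; last by rewrite eqxx.
  move=> c1 c2 eq12; apply: a_inj => // [[|j]] lt; last exact: eq12.
  by rewrite a1 a2.
move: factorP => /(subP 0%N isT) factorP.
rewrite -[X in X \in _](subrK (\sum_i' e (c i') *
  (x 0%N ^+ (a i' 0%N - a i0 0%N) * Y i'))).
rewrite rpredD // -sumrB rpred_sum // => i' _.
rewrite /b; case: (a i' 0%N =P _) => [->|/eqP ne].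
  by rewrite subnn mul1r subrr rpred0.
have [->|ci'] := eqVneq (c i') 0; first by rewrite rmorph0 !mul0r subrr rpred0.
have : (a i0 0 < a i' 0)%N by rewrite ltn_neqAle eq_sym ne min_i0.
rewrite rmorph0 mul0r sub0r rpredN -subn_gt0 => /prednK <-.
by rewrite exprSr -mulrA mulrCA [x 0%N * _]mulrC !mulrA idealMr ?xP.
Qed.

Lemma linear_dependence (I J : finType) (w : J -> A) (u : I -> A) :
  (#|J| < #|I|)%N ->
  (forall i, exists c : J -> k, u i = \sum_j e (c j) * w j) ->
  exists2 c : I -> k, exists i, c i != 0 & \sum_i e (c i) * u i = 0.
Proof.
move=> ltJI /choice[C uE].
pose B := \matrix_(i < #|I|, j < #|J|) C (enum_val i) (enum_val j).
have /rowV0Pn[v vB v_neq0] : kermx B != 0.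
  by rewrite kermx_eq0 /row_free neq_ltn (leq_ltn_trans (rank_leq_col B)).
exists (fun i => v 0 (enum_rank i)).
  have [j vj] : exists j, v 0 j != 0.
    by apply/existsP; apply: contraNT v_neq0 => /existsPn v0;
       apply/eqP/rowP => j; rewrite mxE; apply/eqP/negPn/v0.
  by exists (enum_val j); rewrite enum_valK.
transitivity (\sum_j e (\sum_i v 0 (enum_rank i) * C i j) * w j).
  under eq_bigr => i _ do rewrite uE mulr_sumr.
  rewrite exchange_big; apply: eq_bigr => j _.
  rewrite rmorph_sum mulr_suml; apply: eq_bigr => i _.
  by rewrite rmorphM mulrA.
rewrite big1 // => j _.
have /matrixP/(_ 0 (enum_rank j)) := sub_kermxP vB.
rewrite !mxE => vB0.
suff -> : \sum_i v 0 (enum_rank i) * C i j = 0 by rewrite rmorph0 mul0r.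
rewrite -[RHS]vB0 (reindex (@enum_val I I)) /=; last exact/onW_bij/enum_val_bij.
by apply: eq_bigr => i _; rewrite enum_valK mxE enum_rankK.
Qed.

Context (d : nat) (z : 'I_d -> A).

Definition monom_of (b : 'I_d -> nat) : A := \prod_l z l ^+ b l.

(** The polynomials in the [z l] of degree at most [N] in each of them.  As
    an inductive predicate it makes closure under the ring operations plain
    inductions; [box_spanE] recovers the coefficients. *)
Inductive box_span (N : nat) : A -> Prop :=
| BoxSpan0 : box_span N 0
| BoxSpanD c b x : (forall l, b l <= N)%N -> box_span N x ->
    box_span N (e c * monom_of b + x).

Lemma box_span_le N N' x : (N <= N')%N -> box_span N x -> box_span N' x.
Proof.
move=> le; elim=> [|c b {}x ltb _ IH]; constructor=> // l.
exact: leq_trans le.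
Qed.

Lemma box_spanD N x y : box_span N x -> box_span N y -> box_span N (x + y).
Proof.
move=> Nx Ny; elim: Nx => [|c b {}x ltb _ IH]; first by rewrite add0r.
by rewrite -addrA; constructor.
Qed.

Lemma box_spanM N N' x y :
  box_span N x -> box_span N' y -> box_span (N + N') (x * y).
Proof.
move=> Nx Ny; elim: Nx => [|c b {}x ltb _ IH].
  by rewrite mul0r; constructor.
rewrite mulrDl; apply: box_spanD IH.
elim: Ny => [|c' b' {}y ltb' _ IH]; first by rewrite mulr0; constructor.
rewrite mulrDr mulrACA -rmorphM.
have -> : monom_of b * monom_of b' = monom_of (fun l => b l + b' l)%N.
  by rewrite -big_split; apply: eq_bigr => l _; rewrite exprD.
by constructor=> // l; apply: leq_add.
Qed.

Lemma box_spanC N c : box_span N (e c).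
Proof.
have -> : e c = e c * monom_of (fun=> 0%N) + 0.
  by rewrite addr0 /monom_of big1 ?mulr1.
by constructor=> //; constructor.
Qed.

Lemma box_spanX N x r : box_span N x -> box_span (r * N) (x ^+ r).
Proof.
move=> Nx; elim: r => [|r IH].
  by rewrite expr0 -(rmorph1 e); apply: box_spanC.
by rewrite exprS mulSn; apply: box_spanM.
Qed.

Lemma box_span_gen l : box_span 1 (z l).
Proof.
have -> : z l = e 1 * monom_of (fun l' => (l' == l) : nat) + 0.
  rewrite rmorph1 mul1r addr0 /monom_of (bigD1 l) //= eqxx big1 ?mulr1 //.
  by move=> l' /negPf->.
by constructor=> [l'|]; [apply: leq_b1 | constructor].
Qed.

Lemma box_span_prod N m (x : 'I_m -> A) :
  (forall j, box_span N (x j)) -> box_span (m * N) (\prod_j x j).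
Proof.
elim: m x => [|m IHm] x Nx.
  by rewrite big_ord0 -(rmorph1 e); apply: box_spanC.
by rewrite big_ord_recl mulSn; apply: box_spanM; [|apply: IHm].
Qed.

Lemma box_spanE N x : box_span N x ->
  exists c : {ffun 'I_d -> 'I_N.+1} -> k,
    x = \sum_b e (c b) * monom_of (fun l => b l).
Proof.
elim=> [|c b {}x leb _ [c' ->]].
  by exists (fun=> 0); rewrite big1 // => b _; rewrite rmorph0 mul0r.
pose b' := [ffun l => inord (b l)] : {ffun 'I_d -> 'I_N.+1}.
exists (fun b'' => (if b'' == b' then c else 0) + c' b'').
transitivity (\sum_b'' (e (if b'' == b' then c else 0) * monom_of (fun l => b'' l)
    + e (c' b'') * monom_of (fun l => b'' l))); last first.
  by apply: eq_bigr => b'' _; rewrite rmorphD mulrDl.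
rewrite big_split /=; congr (_ + _).
rewrite (bigD1 b') //= eqxx big1 => [|b'' /negPf->]; last first.
  by rewrite rmorph0 mul0r.
rewrite addr0; congr (_ * _); apply: eq_bigr => l _.
by rewrite ffunE inordK // ltnS.
Qed.

Definition polynomial_in (x : A) : Prop := exists N, box_span N x.

Lemma polynomial_inD x y :
  polynomial_in x -> polynomial_in y -> polynomial_in (x + y).
Proof.
move=> [N Nx] [N' Ny]; exists (maxn N N').
by apply: box_spanD; [apply: box_span_le Nx | apply: box_span_le Ny];
  rewrite ?leq_maxl ?leq_maxr.
Qed.

Lemma polynomial_inM x y :
  polynomial_in x -> polynomial_in y -> polynomial_in (x * y).
Proof. by move=> [N Nx] [N' Ny]; exists (N + N')%N; apply: box_spanM. Qed.

Lemma polynomial_inC c : polynomial_in (e c).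
Proof. by exists 0%N; apply: box_spanC. Qed.

Lemma polynomial_in0 : polynomial_in 0.
Proof. by rewrite -(rmorph0 e); apply: polynomial_inC. Qed.

Lemma polynomial_in_gen l : polynomial_in (z l).
Proof. by exists 1%N; apply: box_span_gen. Qed.

Lemma polynomial_in_peval (V : choiceType) (g : V -> A) (f : polyring k V) :
  (forall v, polynomial_in (g v)) -> polynomial_in (peval e g f).
Proof.
have one_in : polynomial_in 1 by rewrite -(rmorph1 e); apply: polynomial_inC.
move=> gin; apply: (big_ind polynomial_in); first exact: polynomial_in0.
  exact: polynomial_inD.
move=> m _; apply: polynomial_inM; first exact: polynomial_inC.
apply: (big_ind polynomial_in) => // [|v _]; first exact: polynomial_inM.
elim: (m v) => [|r IH]; first by rewrite expr0.
by rewrite exprS; apply: polynomial_inM.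
Qed.

(** A chain longer than [d] would give [m > d] elements [x_j] without
    polynomial relations, but their monomials of degree at most [N] in each
    [x_j] are more numerous, for large [N], than the monomials in the [z l]
    that they are combinations of. *)
Lemma prime_chain_le m (P : 'I_m.+1 -> prime_idealr A) :
  (forall y, polynomial_in y) -> prime_chain P -> (m <= d)%N.
Proof.
move=> gen chainP; rewrite leqNgt; apply/negP => ltdm.
pose Q j := P (inord j).
have ordK j : (j <= m)%N -> (inord j : 'I_m.+1) = j :> nat.
  by move=> le; rewrite inordK.
have Qchain j : (j < m)%N ->
    {subset Q j <= Q j.+1} /\ ~ {subset Q j.+1 <= Q j}.
  by move=> lt; apply: chainP; rewrite !ordK // ltnW.
have /choice[x xP] : forall j, exists x,
    (j < m)%N -> x \in Q j.+1 /\ x \notin Q j.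
  move=> j; have [lt|ge] := boolP (j < m)%N; last by exists 0.
  have [_ nsub] := Qchain j lt; apply: contrapT => /forallNP nex.
  apply: nsub => x Qx; apply/negP => /negP NQx.
  by apply: (nex x).
have /choice[D0 D0P] := fun j => gen (x j).
pose D := (\max_(j < m) D0 j)%N.
have xD (j : 'I_m) : box_span D (x j).
  by apply: box_span_le (D0P j); apply: leq_bigmax.
(* The [u a] are combinations of [(m * N * D).+1 ^ d] monomials, a number at
   most [N.+1 ^ d * (m * D).+1 ^ d = N.+1 ^ d * N < N.+1 ^ d.+1]. *)
pose N := ((m * D).+1 ^ d)%N.
pose I := {ffun 'I_m -> 'I_N.+1}.
pose u (a : I) := \prod_(j < m) x j ^+ a j.
have uE (a : I) : exists c : {ffun 'I_d -> 'I_(m * (N * D)).+1} -> k,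
    u a = \sum_b e (c b) * monom_of (fun l => b l).
  apply/box_spanE/box_span_prod => j; apply: box_span_le (box_spanX (a j) (xD j)).
  by rewrite leq_mul // -ltnS.
have card_lt : (#|{ffun 'I_d -> 'I_(m * (N * D)).+1}| < #|I|)%N.
  rewrite /I !card_ffun !card_ord.
  apply: (@leq_ltn_trans (N.+1 ^ d * N)).
    rewrite -expnMn; case: (d) => // d'; rewrite leq_exp2r //.
    by rewrite mulnCA mulSn mulnS addSn ltnS addnA leq_addl.
  apply: (@leq_trans (N.+1 ^ d.+1)); last by rewrite leq_pexp2l.
  by rewrite expnSr ltn_mul2l expn_gt0 ltnS leqnn.
have [c [a ca] c0] := linear_dependence card_lt uE.
suff /(_ a) : forall a, c a = 0 by move/eqP: ca.
apply: (@chain_algebraically_free _ Q m x (fun (a : I) j =>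
  oapp (fun j' => a j' : nat) 0%N (insub j)) c).
- by move=> j /Qchain[].
- by move=> j /xP[].
- by move=> j /xP[].
- move=> a1 a2 _ _ eq12; apply/ffunP => j; apply: val_inj.
  by have := eq12 j (ltn_ord j); rewrite valK.
suff -> : \sum_i e (c i) * \prod_(j < m)
    x j ^+ oapp (fun j' => i j' : nat) 0%N (insub (j : nat)) = 0 by apply: rpred0.
rewrite -[RHS]c0; apply: eq_bigr => a' _; congr (_ * _).
by apply: eq_bigr => j _; rewrite valK.
Qed.

End KrullUpperBound.

(** * Extending solutions of the linear relations in a submodule *)

Section MmapLemmas.
Context (k : comNzRingType) (V : choiceType) (W : comNzRingType).
Context (e : {rmorphism k -> W}).
Local Notation N := {malg k[V]}.

Lemma mmap_scale (g : V -> W) a (h : N) : mmap e g (a *: h) = e a * mmap e g h.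
Proof.
rewrite (mmapEw (msuppZ_le _ _)) mmapE mulr_sumr; apply: eq_bigr => v _.
by rewrite /= mcoeffZ rmorphM mulrA.
Qed.

Lemma eq_mmap (g1 g2 : V -> W) (h : N) :
  {in msupp h, g1 =1 g2} -> mmap e g1 h = mmap e g2 h.
Proof. by move=> eq12; apply: eq_big_seq => v /eq12 ->. Qed.

Lemma mmap_upd (g : V -> W) v w (h : N) :
  mmap e (fun u => if u == v then w else g u) h =
  mmap e (fun u => if u == v then 0 else g u) h + e h@_v * w.
Proof.
have le : (msupp h `<=` msupp h `|` [fset v])%fset := fsubsetUl _ _.
have vD : v \in (msupp h `|` [fset v])%fset.
  by rewrite in_fsetU in_fset1 eqxx orbT.
rewrite !(mmapEw le) !(big_fsetD1 v vD) /= !eqxx mulr0 add0r addrC.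
by congr (_ + _); apply: eq_big_seq => u; rewrite in_fsetD1 => /andP[/negPf->].
Qed.

Lemma eq_peval (g1 g2 : V -> W) (f : polyring k V) :
  (forall m v, m \in msupp f -> v \in finsupp m -> g1 v = g2 v) ->
  peval e g1 f = peval e g2 f.
Proof.
move=> eq12; apply: eq_big_seq => m mf; congr (_ * _).
by apply: eq_big_seq => v vm; rewrite (eq12 m v).
Qed.

End MmapLemmas.

Section Extension.
Context (k : fieldType) (V : choiceType) (W : comNzRingType).
Context (e : {rmorphism k -> W}).
Local Notation N := {malg k[V]}.
Context (K : {pred N}) (Kclosed : submod_closed K).

(** The elements of [K] are read as homogeneous linear equations in the
    unknowns [V], and [g] as a solution of those in the unknowns [D] alone. *)
Definition vanishes_on (D : {pred V}) (g : V -> W) : Prop :=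
  forall h, h \in K -> {subset msupp h <= D} -> mmap e g h = 0.

(** If some equation [f] in [K] involves the new unknown [v], solving it for
    [v] gives the only possible value, and subtracting multiples of [f] from
    any other equation reduces it to one without [v].  Otherwise the value at
    [v] is arbitrary. *)
Lemma vanishes_extend1 (D : {pred V}) g v : vanishes_on D g ->
  exists2 g', {in D, g' =1 g} & vanishes_on [predU1 v & D] g'.
Proof.
move=> vanD; have [vD|vND] := boolP (v \in D).
  exists g => // h Kh sub; apply: vanD => // u /sub.
  by rewrite inE => /predU1P[->|].
have [K0 KD] := Kclosed.
pose good f := [/\ f \in K, {subset msupp f <= [predU1 v & D]} & f@_v != 0].
have [[f [Kf fsub fv]]|nex] := pselect (exists f, good f); last first.
  exists g => // h Kh sub; apply: vanD => // u hu.
  move: (sub u hu); rewrite inE => /predU1P[uv|//].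
  by case: nex; exists h; split=> //; rewrite mcoeff_neq0 -uv.
pose g0 u := if u == v then 0 else g u.
pose w := - e (f@_v)^-1 * mmap e g0 f.
exists (fun u => if u == v then w else g u).
  by move=> u uD /=; case: eqVneq => // uv; rewrite -uv uD in vND.
move=> h Kh hsub; rewrite mmap_upd.
pose c := h@_v / f@_v; pose h' := - c *: f + h.
have h'v : h'@_v = 0 by rewrite mcoeffD mcoeffZ mulNr divfK // addNr.
have h'D u : u \in msupp h' -> u \in D.
  move=> uh'; have : u != v.
    by apply: contraTneq uh' => ->; rewrite -mcoeff_eq0 h'v.
  have /fsetUP : u \in (msupp (- c *: f) `|` msupp h)%fset.
    exact: (fsubsetP (msuppD_le _ _)).
  move=> uU /negPf uv; suff : u \in [predU1 v & D] by rewrite inE /= uv.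
  by case: uU => [/(fsubsetP (msuppZ_le _ _))/fsub|/hsub].
have : mmap e g0 h' = 0.
  rewrite -(vanD h' (KD _ _ _ Kf Kh) h'D); apply: eq_mmap => u /h'D uD.
  by rewrite /g0; case: eqVneq => // uv; rewrite -uv uD in vND.
rewrite mmapD mmap_scale => /eqP; rewrite addrC addr_eq0 => /eqP ->.
by rewrite rmorphN mulNr opprK rmorphM /w mulNr mulrN mulrA subrr.
Qed.

Lemma vanishes_extend (D : {pred V}) g (s : seq V) : vanishes_on D g ->
  exists2 g', {in D, g' =1 g} & vanishes_on [predU s & D] g'.
Proof.
elim: s g => [|v s IHs] g vanD.
  by exists g => // h Kh sub; apply: vanD => // u /sub; rewrite !inE.
have [g1 eq1 /(vanishes_extend1 v)[g2 eq2 van2]] := IHs g vanD.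
exists g2 => [u uD|h Kh sub]; first by rewrite eq2 ?inE ?uD ?orbT ?eq1.
by apply: van2 => // u /sub; rewrite !inE orbA.
Qed.

End Extension.

Section GroupIdeal.
Context (n : nat) (k : sigmaField n) (s : nat).
Context (K : sigmaSubmodule (free_module k s)).
Context (W : comNzRingType) (e : {rmorphism k -> W}).

(** An element of [(K)] is a combination of finitely many elements of [K], so
    only the equations in a finite set of unknowns matter for it. *)
Lemma group_ideal_finite f : f \in group_ideal K ->
  exists D : seq (svar n s), forall g,
    vanishes_on e (K : {pred {malg k[svar n s]}}) (mem D) g -> peval e g f = 0.
Proof.
move: f; apply: group_ideal_ind => [|h Kh]; last first.
  exists (msupp (h : {malg k[svar n s]})) => g vang; rewrite peval_lin.
  exact: vang.
split=> [|a x y [Dx x0] [Dy y0]]; first by exists [::] => g _; rewrite rmorph0.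
exists (Dx ++ Dy) => g vang; rewrite rmorphD rmorphM /=.
rewrite x0 ?y0 ?mulr0 ?addr0 //; move=> h Kh sub; apply: vang => // u /sub uD;
  change (u \in Dx ++ Dy); rewrite mem_cat; apply/orP; by [left | right].
Qed.

(** The linear relations of order at most [i] in [K] account for all of
    [(K) :&: k[G_a^s[i]]]: the values [g] at the variables of order at most
    [i] extend to a solution of the equations that matter for [f]. *)
Lemma group_ideal_peval i (g : svar n s -> W) f :
  vanishes_on e (K : {pred {malg k[svar n s]}}) [pred v | svord v <= i]%N g ->
  f \in group_ideal K -> f \in ord_le i -> peval e g f = 0.
Proof.
move=> vang /group_ideal_finite[D D0] /ord_leP fi.
have [g' eqg vang'] := vanishes_extend (ssub_closed K) D vang.
rewrite -[RHS](D0 g').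
  by apply: eq_peval => m v mf vm; rewrite eqg // inE (fi m v).
by move=> h Kh sub; apply: vang' => // u /sub; rewrite !inE => ->.
Qed.

End GroupIdeal.

(** * Chains of primes from algebraically independent elements *)

Section Kernel.
Context (A : comNzRingType) (T : idomainType) (f : {rmorphism A -> T}).

Definition ker_ideal : {pred A} := fun a => f a == 0.

Lemma ker_ideal_closed : idealr_closed ker_ideal.
Proof.
split=> [||a x y]; rewrite /ker_ideal !unfold_in ?rmorph0 ?rmorph1 ?oner_eq0 //.
by move=> /eqP fx /eqP fy; rewrite rmorphD rmorphM fx fy mulr0 addr0.
Qed.

Lemma ker_ideal_prime : prime_idealr_closed ker_ideal.
Proof. by move=> x y; rewrite /ker_ideal !unfold_in rmorphM mulf_eq0. Qed.

HB.instance Definition _ := isIdealr.Build A ker_ideal ker_ideal_closed.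
HB.instance Definition _ :=
  isPrimeIdealrClosed.Build A ker_ideal ker_ideal_prime.

End Kernel.

Section LowerBound.
Import mpoly.
Context (k : fieldType) (A : comNzRingType) (d : nat).

Lemma mpoly_rmorph_ext (T : comNzRingType) (f g : {rmorphism mpoly d k -> T}) :
  (forall c, f c%:MP = g c%:MP) -> (forall l, f 'X_l = g 'X_l) -> f =1 g.
Proof.
move=> eqC eqX; elim/mpolyind => [|c m p _ _ IH]; first by rewrite !rmorph0.
rewrite -mul_mpolyC !rmorphD !rmorphM /= IH eqC; congr (_ * _ + _).
rewrite mpolyXE_id !rmorph_prod; apply: eq_bigr => l _.
by rewrite !rmorphXn /= eqX.
Qed.

Lemma kill_first_variables :
  exists kill : nat -> {rmorphism mpoly d k -> mpoly d k},
    (forall j c, kill j c%:MP = c%:MP) /\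
    (forall j l, kill j 'X_l = if (l < j)%N then 0 else 'X_l).
Proof.
exists (fun j => comp_mpoly [tuple if (l < j)%N then 0 else 'X_l | l < d]).
split=> [j c|j l] /=; first exact: comp_mpolyC.
by rewrite comp_mpolyXU -tnth_nth tnth_mktuple.
Qed.

(** The hypothesis is the universal property of the polynomial ring, short of
    uniqueness, for the [a l]: it makes them algebraically independent over
    [k]. *)
Lemma prime_chain_exists (a : 'I_d -> A) :
  (forall (T : idomainType) (e : {rmorphism k -> T}) (x : 'I_d -> T),
     exists theta : {rmorphism A -> T}, forall l, theta (a l) = x l) ->
  exists P : 'I_d.+1 -> prime_idealr A, prime_chain P.
Proof.
move=> free; have [theta thetaX] := free _ (@mpolyC d k) (fun l => 'X_l).
have [kill [killC killX]] := kill_first_variables.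
have kill_comp j j' : (j <= j')%N -> kill j' \o kill j =1 kill j'.
  move=> le; apply: mpoly_rmorph_ext => [c|l] /=; first by rewrite !killC.
  rewrite [kill j _]killX; case: ltnP => [lt|//].
  by rewrite rmorph0 killX (leq_trans lt le).
exists (fun j => ker_ideal (kill j \o theta) : prime_idealr A) => j j' lt.
have kerE (r : nat) x :
    x \in ker_ideal (kill r \o theta) = (kill r (theta x) == 0) by [].
split=> [x|].
  by rewrite !kerE -(kill_comp _ _ (ltnW lt)) /= => /eqP->; rewrite rmorph0.
have ltd : (j < d)%N by apply: leq_trans lt _; rewrite -ltnS.
move=> /(_ (a (Ordinal ltd))); rewrite !kerE thetaX !killX /= lt eqxx ltnn.
by move=> /(_ isT); rewrite -msupp_eq0 msuppX.
Qed.

End LowerBound.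

(** * Polynomials in the variables of order at most [i] *)

Lemma cmonom_split (V : choiceType) r (m : {cmonom V}) : mdeg m = r.+1 ->
  exists v m', m = mmul (ucm v) m' /\ mdeg m' = r.
Proof.
move=> degm; have [v vm] : exists v, v \in finsupp m.
  apply/fset0Pn; apply: contra_eq_neq degm => m0.
  by rewrite mdegE m0 big_seq_fset0.
have m_eq : m = mmul (ucm v) (divcm m (ucm v)).
  apply/eqP/cmP => i; rewrite cmM cmU divcmE ucmE subnKC //.
  by case: eqVneq => // <-; rewrite lt0n cmE_neq0.
exists v, (divcm m (ucm v)); split=> //.
by move: degm; rewrite {1}m_eq mdegM mdegU add1n => -[].
Qed.

Section Peval.
Context (k : comNzRingType) (V : choiceType).

Lemma meval_mvar (m : {cmonom V}) : meval (@mvar V k) m = << m >>.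
Proof.
elim: {m}(mdeg m) {-2}m (erefl (mdeg m)) => [|r IHr] m degm.
  by rewrite (mdeg_eq0I degm) (meval_mmorphism _).2.
have [v [m' [-> degm']]] := cmonom_split degm.
rewrite (meval_mmorphism _).1 mevalU IHr //.
by rewrite malgM_def fgmulUU mulr1.
Qed.

Lemma peval_id (f : polyring k V) :
  peval (@malgC {cmonom V} k) (@mvar V k) f = f.
Proof.
rewrite [RHS]monalgE; apply: eq_bigr => m _; rewrite meval_mvar.
by rewrite malgM_def fgmulUU mul1m mulr1.
Qed.

Lemma rmorph_peval (S T : comNzRingType) (e : {rmorphism k -> S}) (g : V -> S)
    (q : {rmorphism S -> T}) (f : polyring k V) :
  q (peval e g f) = peval (q \o e) (q \o g) f.
Proof.
rewrite rmorph_sum; apply: eq_bigr => m _; rewrite rmorphM rmorph_prod.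
by congr (_ * _); apply: eq_bigr => v _; rewrite rmorphXn.
Qed.

End Peval.

Section OrderFiltration.
Context (n : nat) (k : sigmaField n) (s i : nat).
Local Notation N := {malg k[svar n s]}.
Local Notation ordi := [pred v : svar n s | (svord v <= i)%N].

Lemma ord_le_const c : (c%:MP : spoly k s) \in ord_le i.
Proof.
by apply/ord_leP => m v /(fsubsetP (msuppC_le _))/fset1P->; rewrite mdom1.
Qed.

Lemma ord_le_mvar (v : svar n s) : (svord v <= i)%N ->
  (mvar v : spoly k s) \in ord_le i.
Proof.
move=> vi; apply/ord_leP => m w; rewrite msuppU1 => /fset1P ->.
by rewrite mdomU => /fset1P ->.
Qed.

Lemma ord_le_lin (h : N) : {subset msupp h <= ordi} -> lin_spoly h \in ord_le i.
Proof.
move=> hi; rewrite /lin_spoly mmapE big_seq; apply: rpred_sum => v /hi vi.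
by apply: rpredM; [apply: ord_le_const | apply: ord_le_mvar].
Qed.

Definition opoly_const (c : k) : opoly k s i := OPoly (ord_le_const c).

Lemma opoly_const_zmod : zmod_morphism opoly_const.
Proof. by move=> a b; apply: val_inj; rewrite /= raddfB. Qed.

Lemma opoly_const_monoid : monoid_morphism opoly_const.
Proof. by split=> [|a b]; apply: val_inj; rewrite /= ?rmorphM. Qed.

HB.instance Definition _ :=
  GRing.isZmodMorphism.Build k (opoly k s i) opoly_const opoly_const_zmod.
HB.instance Definition _ :=
  GRing.isMonoidMorphism.Build k (opoly k s i) opoly_const opoly_const_monoid.

(** The default value [0] makes the variables of order greater than [i]
    vanish. *)
Definition opoly_var (v : svar n s) : opoly k s i :=
  insubd 0 (mvar v : spoly k s).

Lemma opoly_varE v : v \in ordi -> opval (opoly_var v) = mvar v.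
Proof. by move=> vi; rewrite /opoly_var insubdK //; apply: ord_le_mvar. Qed.

Lemma opoly_var_out v : v \notin ordi -> opoly_var v = 0.
Proof.
move=> vNi; rewrite /opoly_var /insubd insubN //; apply: contra vNi => /ord_leP.
by apply; rewrite ?msuppU1 ?in_fset1 // mdomU in_fset1.
Qed.

(** A retraction of [k{y}] onto its subring [k[G_a^s[i]]]. *)
Definition restrict : spoly k s -> opoly k s i := peval opoly_const opoly_var.

HB.instance Definition _ := GRing.RMorphism.on restrict.

Lemma restrictK f : f \in ord_le i -> opval (restrict f) = f.
Proof.
move=> /ord_leP fi.
rewrite -[RHS](peval_id (f : polyring k (svar n s))).
rewrite [LHS](rmorph_peval (opoly_const : {rmorphism k -> _}) _
  (val : {rmorphism opoly k s i -> spoly k s})).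
apply: eq_peval => m v mf vm.
by apply: opoly_varE; apply: fi mf vm.
Qed.

End OrderFiltration.

(** * The coordinate ring of [G[i]] as a polynomial ring *)

Lemma malgU_scale (R : comNzRingType) (V : choiceType) (c : R) (v : V) :
  << c *g v >> = c *: << v >> :> {malg R[V]}.
Proof. by apply/malgP => w; rewrite mcoeffZ mcoeffU mcoeffU mulr_natr. Qed.

Section Filtration.
Context (n : nat) (k : sigmaField n) (M : sigmaModule k) (s : nat).
Context (K : sigmaSubmodule (free_module k s)) (pi : presentation M K) (i : nat).
Local Notation N := {malg k[svar n s]}.
Local Notation ordi := [pred v : svar n s | (svord v <= i)%N].

(** The presentation, with its source seen as the space of formal linear
    combinations of the variables, to which the linear structure of
    [{malg k[_]}] applies. *)
Definition pres_fun (h : N) : M := pi h.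

Lemma pres_fun_linear : linear pres_fun.
Proof. by move=> a x y; apply: linearP. Qed.

HB.instance Definition _ :=
  GRing.isLinear.Build k N M _ pres_fun pres_fun_linear.

Lemma presEw (D : {fset svar n s}) (h : N) : (msupp h `<=` D)%fset ->
  pi h = \sum_(v <- D) h@_v *: pi << v >>.
Proof.
move=> hD; change (pres_fun h = \sum_(v <- D) h@_v *: pres_fun << v >>).
rewrite {1}(monalgEw hD) raddf_sum; apply: eq_bigr => v _.
by rewrite malgU_scale /= linearZ.
Qed.

Lemma presE (h : N) : pi h = \sum_(v <- msupp h) h@_v *: pi << v >>.
Proof. exact: presEw. Qed.

Lemma std_filtrationP x : std_filtration pi i%:Z x <->
  exists2 h : N, {subset msupp h <= ordi} & x = pi h.
Proof.
split=> [[r [a [b [bP ->]]]]|[h hi ->]].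
  have /choice[v vP] := bP.
  exists (\sum_j a j *: << v j >>) => [w|].
    apply: contraTT => wi; rewrite -mcoeff_eq0 raddf_sum big1 // => j _.
    rewrite /= mcoeffZ mcoeffU; case: eqP => [vw|_]; last by rewrite mulr0.
    by move: (vP j) wi => [vi _]; rewrite inE -vw -lez_nat vi.
  rewrite -/(pres_fun _) raddf_sum; apply: eq_bigr => j _.
  by rewrite (vP j).2 /= linearZ.
pose S := msupp h; rewrite presE -/S.
exists (size S), (fun j => h@_(tnth (in_tuple S) j)),
  (fun j => pi << tnth (in_tuple S) j >>).
split=> [j|]; last by rewrite (big_tnth _ _ S).
by exists (tnth (in_tuple S) j); split=> //; apply: hi; apply: mem_tnth.
Qed.

Lemma pres_kerP (h : N) : (h : free_module k s) \in K -> pres_fun h = 0.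
Proof. by move/pres_ker; apply. Qed.

Definition zcl_pi : opoly k s i -> zcl_ring (group_of K) i :=
  \pi_{ideal_quot (zcl_ideal (i:=i) (group_of K))}.

HB.instance Definition _ := GRing.RMorphism.on zcl_pi.

Definition zcl_lin (h : N) : zcl_ring (group_of K) i :=
  zcl_pi (restrict i (lin_spoly h)).

Definition zcl_const (c : k) : zcl_ring (group_of K) i :=
  zcl_pi (opoly_const s i c).

HB.instance Definition _ :=
  GRing.RMorphism.copy zcl_const (zcl_pi \o opoly_const s i).

Lemma zcl_linE h : zcl_lin h = mmap zcl_const (zcl_pi \o opoly_var k i) h.
Proof.
rewrite /zcl_lin /restrict peval_lin raddf_sum; apply: eq_bigr => v _.
by rewrite /= rmorphM.
Qed.

Lemma zcl_lin_ker (h : N) :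
  (h : free_module k s) \in K -> {subset msupp h <= ordi} -> zcl_lin h = 0.
Proof.
move=> Kh hi; apply/eqP; rewrite -(rmorph0 zcl_pi) -Quotient.idealrBE subr0.
by rewrite inE restrictK ?ord_le_lin //; apply: group_ideal_lin.
Qed.

Section Coordinates.
Context (d : nat) (b : 'I_d -> M).
Context (b_free : forall a : 'I_d -> k,
  \sum_l a l *: b l = 0 -> forall l, a l = 0).
Context (C : svar n s -> 'I_d -> k).
Context (CE : forall v, v \in ordi -> pi << v >> = \sum_l C v l *: b l).
Context (h : 'I_d -> N).
Context (h_ord : forall l, {subset msupp (h l) <= ordi}).
Context (hE : forall l, pi (h l) = b l).

Section Map.
Context (T : comNzRingType) (e : {rmorphism k -> T}) (x : 'I_d -> T).

(** The images of the variables under the map sending the classes of the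
    [h l] to the [x l]. *)
Definition coord_val (v : svar n s) : T := \sum_l e (C v l) * x l.

Lemma mmap_coord (f : N) (a : 'I_d -> k) : {subset msupp f <= ordi} ->
  pi f = \sum_l a l *: b l -> mmap e coord_val f = \sum_l e (a l) * x l.
Proof.
move=> fi; rewrite presE => fE.
have aE l : a l = \sum_(v <- msupp f) f@_v * C v l.
  apply/eqP; rewrite -subr_eq0; apply/eqP; move: l; apply: b_free.
  under eq_bigr => l _ do rewrite scalerBl scaler_suml.
  rewrite sumrB exchange_big -fE /=; apply/eqP; rewrite subr_eq0; apply/eqP.
  rewrite big_seq [RHS]big_seq; apply: eq_bigr => v /fi vi.
  by rewrite CE // scaler_sumr; apply: eq_bigr => l _; rewrite scalerA.
rewrite mmapE; under eq_bigr => v _ do rewrite mulr_sumr.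
rewrite exchange_big; apply: eq_bigr => l _ /=.
rewrite aE rmorph_sum mulr_suml; apply: eq_bigr => v _.
by rewrite rmorphM mulrA.
Qed.

Lemma coord_val_vanishes :
  vanishes_on e (K : {pred N}) ordi coord_val.
Proof.
move=> f Kf fi; rewrite (mmap_coord (a := fun=> 0) fi).
  by rewrite big1 // => l _; rewrite rmorph0 mul0r.
rewrite [LHS](pres_kerP Kf) big1 // => l _; exact: scale0r.
Qed.

(** Well defined on classes by [coord_val_vanishes] and
    [group_ideal_peval]; see [zcl_mapE]. *)
Definition zcl_map (a : zcl_ring (group_of K) i) : T :=
  peval e coord_val (opval (repr a)).

Lemma zcl_mapE f : zcl_map (zcl_pi f) = peval e coord_val (opval f).
Proof.
apply/eqP; rewrite -subr_eq0 -rmorphB /=; apply/eqP.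
apply: (group_ideal_peval (i := i) coord_val_vanishes).
  have : repr (zcl_pi f) - f \in zcl_ideal (i:=i) (group_of K).
    by rewrite Quotient.idealrBE reprK.
  by [].
exact: (opvalP (repr (zcl_pi f) - f)).
Qed.

Lemma zcl_map_zmod : zmod_morphism zcl_map.
Proof.
move=> u v; rewrite -[u]reprK -[v]reprK.
by rewrite -(rmorphB zcl_pi) !zcl_mapE rmorphB.
Qed.

Lemma zcl_map_monoid : monoid_morphism zcl_map.
Proof.
split=> [|u v]; first by rewrite -(rmorph1 zcl_pi) zcl_mapE rmorph1.
rewrite -[u]reprK -[v]reprK.
by rewrite -(rmorphM zcl_pi) !zcl_mapE rmorphM.
Qed.

HB.instance Definition _ :=
  GRing.isZmodMorphism.Build _ _ zcl_map zcl_map_zmod.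
HB.instance Definition _ :=
  GRing.isMonoidMorphism.Build _ _ zcl_map zcl_map_monoid.

Lemma zcl_map_lin l : zcl_map (zcl_lin (h l)) = x l.
Proof.
rewrite zcl_mapE restrictK ?ord_le_lin // peval_lin.
rewrite (mmap_coord (a := fun l' => (l' == l)%:R) (@h_ord l)).
  rewrite (bigD1 l) //= eqxx rmorph1 mul1r big1 ?addr0 // => l' /negPf->.
  by rewrite rmorph0 mul0r.
rewrite hE (bigD1 l) //= eqxx scale1r big1 ?addr0 // => l' /negPf->.
exact: scale0r.
Qed.

(** The classes of the [h l] satisfy no polynomial relation over [k]. *)
Lemma zcl_map_exists : exists theta : {rmorphism zcl_ring (group_of K) i -> T},
  forall l, theta (zcl_lin (h l)) = x l.
Proof. by exists zcl_map; apply: zcl_map_lin. Qed.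

End Map.

(** A variable [v] of order at most [i] differs from the combination of the
    [h l] with the coordinates of its image in [M] by an element of [K]. *)
Lemma zcl_generates u : polynomial_in zcl_const (zcl_lin \o h) u.
Proof.
pose S := polynomial_in zcl_const (zcl_lin \o h).
have Svar v : S (zcl_pi (opoly_var k i v)).
  have [vi|vNi] := boolP (v \in ordi); last first.
    by rewrite opoly_var_out // rmorph0; apply: polynomial_in0.
  suff -> : zcl_pi (opoly_var k i v) = \sum_l zcl_const (C v l) * zcl_lin (h l).
    apply: (big_ind S) => [||l _]; first exact: polynomial_in0.
      exact: polynomial_inD.
    apply: polynomial_inM; first exact: polynomial_inC.
    exact: (polynomial_in_gen zcl_const (zcl_lin \o h)).
  pose f : N := << v >> - \sum_l C v l *: h l.
  have fi : {subset msupp f <= ordi}.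
    move=> w /(fsubsetP (msuppB_le _ _))/fsetUP[].
      by move=> /(fsubsetP msuppU_le)/fset1P->.
    apply: contraTT => wi; rewrite -mcoeff_eq0 raddf_sum big1 // => l _.
    rewrite /= mcoeffZ mcoeff_outdom ?mulr0 //.
    by apply: contra wi; apply: h_ord.
  have Kf : (f : free_module k s) \in K.
    apply/(pres_ker pi); rewrite -/(pres_fun f) raddfB raddf_sum /=.
    rewrite /pres_fun CE // -sumrB big1 // => l _.
    by rewrite -/(pres_fun _) linearZ /= /pres_fun hE subrr.
  have sumE : zcl_lin (\sum_l C v l *: h l) =
      \sum_l zcl_const (C v l) * zcl_lin (h l).
    rewrite zcl_linE raddf_sum; apply: eq_bigr => l _.
    by rewrite /= mmap_scale zcl_linE.
  have := zcl_lin_ker Kf fi; rewrite zcl_linE mmapB -!zcl_linE sumE.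
  move/eqP; rewrite subr_eq0 => /eqP <-.
  by rewrite zcl_linE mmapU [X in X * _]rmorph1 mul1r.
rewrite -[u]reprK; set f := repr u.
have -> : f = restrict i (opval f).
  by apply: val_inj; rewrite /= restrictK // opvalP.
rewrite /restrict (rmorph_peval _ _ zcl_pi).
exact: (@polynomial_in_peval _ _ zcl_const _ (zcl_lin \o h)).
Qed.

End Coordinates.

Lemma has_dim_krull_dim d :
  has_dim (std_filtration pi i%:Z) d -> krull_dim (zcl_ring (group_of K) i) d.
Proof.
move=> [b [b_free b_span]].
have /choice[C CE] : forall v, exists a : 'I_d -> k,
    v \in ordi -> pi << v >> = \sum_l a l *: b l.
  move=> v; have [vi|_] := boolP (v \in ordi); last by exists (fun=> 0).
  have /b_span[a aE] : std_filtration pi i%:Z (pi << v >>).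
    apply/std_filtrationP; exists << v >> => // w.
    by move=> /(fsubsetP msuppU_le)/fset1P->.
  by exists a.
have /choice[h hP] : forall l, exists h : N,
    {subset msupp h <= ordi} /\ pi h = b l.
  move=> l; have /std_filtrationP[h hi ->] : std_filtration pi i%:Z (b l).
    apply/b_span; exists (fun l' => (l' == l)%:R).
    rewrite (bigD1 l) //= eqxx scale1r big1 ?addr0 // => l' /negPf->.
    exact: scale0r.
  by exists h.
have h_ord l := (hP l).1; have hE l := (hP l).2.
split=> [|m P chainP].
  apply: (@prime_chain_exists k _ d (zcl_lin \o h)) => T e x.
  exact: (zcl_map_exists b_free CE h_ord hE e x).
exact: (prime_chain_le (zcl_generates CE h_ord hE) chainP).
Qed.

End Filtration.

(** * Finite dimension of the filtration *)

Lemma finitely_many_cmonom (I : finType) r :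
  exists L : seq {cmonom I}, forall m, (mdeg m <= r)%N -> m \in L.
Proof.
elim: r => [|r [L LP]].
  by exists [:: mone] => m; rewrite leqn0 mdeg_eq0 inE.
exists (L ++ [seq mmul (ucm v) m | v <- enum I, m <- L]) => m.
rewrite leq_eqVlt mem_cat => /predU1P[/cmonom_split[v [m' [-> degm']]]|/LP-> //].
by apply/orP; right; apply/allpairs_f; rewrite ?mem_enum ?LP ?degm'.
Qed.

Lemma eq_has_dim (k : fieldType) (V : lmodType k) (U U' : V -> Prop) d :
  (forall x, U x <-> U' x) -> has_dim U d -> has_dim U' d.
Proof.
move=> eqU [b [b_free b_span]]; exists b; split=> // x.
by rewrite -b_span; split=> /eqU.
Qed.

Lemma has_dim_add_line (k : fieldType) (V : lmodType k) (U : V -> Prop) w d :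
  has_dim U d ->
  exists d', has_dim (fun x => exists c y, U y /\ x = c *: w + y) d'.
Proof.
move=> [b [b_free b_span]].
have [/b_span[c wE]|nUw] := pselect (U w).
  exists d, b; split=> // x.
  split=> [[c' [y [/b_span[a ->] ->]]]|[a ->]].
    exists (fun l => c' * c l + a l); rewrite wE scaler_sumr -big_split.
    by apply: eq_bigr => l _; rewrite scalerDl scalerA.
  exists 0, (\sum_l a l *: b l); rewrite scale0r add0r; split=> //.
  by apply/b_span; exists a.
pose b' (j : 'I_d.+1) := oapp b w (unlift ord0 j).
have b'E (a : 'I_d.+1 -> k) : \sum_j a j *: b' j =
    a ord0 *: w + \sum_l a (lift ord0 l) *: b l.
  rewrite big_ord_recl /b' unlift_none; congr (_ + _).
  by apply: eq_bigr => l _; rewrite liftK.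
exists d.+1, b'; split=> [a|x].
  rewrite b'E => a0; have a00 : a ord0 = 0.
    apply/eqP; apply: contraT => /mulVf ainv; case: nUw; apply/b_span.
    exists (fun l => - (a ord0)^-1 * a (lift ord0 l)).
    move/eqP: a0; rewrite addr_eq0 => /eqP a0.
    rewrite -[LHS]scale1r -ainv -scalerA a0 scalerN scaler_sumr -sumrN.
    by apply: eq_bigr => l _; rewrite scalerA mulNr scaleNr.
  move: a0; rewrite a00 scale0r add0r => /b_free al j.
  by case: (unliftP ord0 j) => [l ->|->].
split=> [[c [y [/b_span[a ->] ->]]]|[a ->]].
  exists (fun l => oapp a c (unlift ord0 l)).
  rewrite b'E unlift_none; congr (_ + _).
  by apply: eq_bigr => l _; rewrite liftK.
exists (a ord0), (\sum_l a (lift ord0 l) *: b l); rewrite b'E; split=> //.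
by apply/b_span; exists (fun l => a (lift ord0 l)).
Qed.

Lemma span_has_dim (k : fieldType) (V : lmodType k) m (w : 'I_m -> V) :
  exists d, has_dim (fun x => exists a : 'I_m -> k, x = \sum_j a j *: w j) d.
Proof.
elim: m w => [|m IHm] w.
  by exists 0%N, w; split=> [a _ []//|x].
have [d /(has_dim_add_line (w ord0))[d' dimd']] := IHm (fun j => w (lift ord0 j)).
exists d'; apply: eq_has_dim dimd' => x.
split=> [[c [y [[a ->] ->]]]|[a ->]].
  exists (fun j => oapp a c (unlift ord0 j)).
  rewrite big_ord_recl unlift_none; congr (_ + _).
  by apply: eq_bigr => j _; rewrite liftK.
exists (a ord0), (\sum_j a (lift ord0 j) *: w (lift ord0 j)).
by rewrite big_ord_recl; split=> //; exists (fun j => a (lift ord0 j)).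
Qed.

Lemma krull_dim_unique (A : comNzRingType) d d' :
  krull_dim A d -> krull_dim A d' -> d = d'.
Proof.
move=> [[P chainP] le_d] [[P' chainP'] le_d'].
by apply/eqP; rewrite eqn_leq (le_d' _ _ chainP) (le_d _ _ chainP').
Qed.

Section Filtration.
Context (n : nat) (k : sigmaField n) (M : sigmaModule k) (s : nat).
Context (K : sigmaSubmodule (free_module k s)) (pi : presentation M K) (i : nat).

Lemma std_filtration_has_dim : exists d, has_dim (std_filtration pi i%:Z) d.
Proof.
have [L LP] := finitely_many_cmonom 'I_n i.
pose D := [fset v in [seq (m, l) | m <- L, l <- enum 'I_s] | (svord v <= i)%N]%fset
  : {fset svar n s}.
have DP (v : svar n s) : (v \in D) = (svord v <= i)%N.
  rewrite !inE /=; case: leqP; rewrite ?andbF ?andbT // => vi.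
  by rewrite [v]surjective_pairing; apply/allpairs_f; rewrite ?mem_enum ?LP.
pose w (j : 'I_(size D)) := pi << tnth (in_tuple D) j >>.
have [d dimw] := span_has_dim w.
exists d; apply: eq_has_dim dimw => x; split=> [[a ->]|].
  exists (size D), a, w; split=> // j; exists (tnth (in_tuple D) j); split=> //.
  by rewrite lez_nat -DP mem_tnth.
move=> /std_filtrationP[h hi ->].
exists (fun j => (h : {malg k[svar n s]})@_(tnth (in_tuple D) j)).
rewrite (presEw pi (D := D)) ?(big_tnth _ _ D) //.
by apply/fsubsetP => v /hi; rewrite DP.
Qed.

Lemma has_dim_iff_krull_dim d :
  has_dim (std_filtration pi i%:Z) d <-> krull_dim (zcl_ring (group_of K) i) d.
Proof.
split=> [|krull_d]; first exact: has_dim_krull_dim.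
have [d' dimd'] := std_filtration_has_dim.
by rewrite (krull_dim_unique krull_d (has_dim_krull_dim dimd')).
Qed.

End Filtration.

(** * Dimension polynomials *)

Lemma poly_eq_of_large_nat (R : numDomainType) (p q : {poly R}) i0 :
  (forall i, (i0 <= i)%N -> p.[i%:R] = q.[i%:R]) -> p = q.
Proof.
move=> eqpq; apply/eqP; rewrite -subr_eq0; apply: contraT => nz.
pose rs := [seq (i%:R : R) | i <- iota i0 (size (p - q))].
have : (size rs < size (p - q)%R)%N.
  apply: max_poly_roots => //.
    apply/allP => x /mapP[i]; rewrite mem_iota => /andP[le _] ->.
    by rewrite /root hornerD hornerN eqpq // subrr.
  by rewrite map_inj_uniq ?iota_uniq // => i j /eqP; rewrite eqr_nat => /eqP.
by rewrite size_map size_iota ltnn.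
Qed.

Lemma dim_poly_unique n (dim : nat -> nat -> Prop) psi phi :
  (forall i d d', dim i d -> dim i d' -> d = d') ->
  is_dim_poly n dim psi -> is_dim_poly n dim phi -> psi = phi.
Proof.
move=> uniq_dim [_ [i1 psiE]] [_ [i2 phiE]].
apply: (@poly_eq_of_large_nat _ _ _ (maxn i1 i2)) => i.
rewrite geq_max => /andP[/psiE[d dimd ->] /phiE[d' dimd' ->]].
by rewrite (uniq_dim _ _ _ dimd dimd').
Qed.

Theorem theorem9p2 (n : nat) (n_gt0 : (0 < n)%N) (k : sigmaField n)
    (M : sigmaModule k) (s : nat) (s_gt0 : (0 < s)%N)
    (K : sigmaSubmodule (free_module k s)) (pi : presentation M K) :
  [/\ forall psi phi : {poly rat},
        module_dim_poly pi psi -> group_dim_poly (group_of K) phi -> psi = phi,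
      forall psi : {poly rat},
        module_dim_poly pi psi <-> group_dim_poly (group_of K) psi,
      forall e : int, module_sigma_dim pi e <-> group_sigma_dim (group_of K) e,
      forall d : nat, module_sigma_type pi d <-> group_sigma_type (group_of K) d
    & forall e : int,
        module_typical_dim pi e <-> group_typical_dim (group_of K) e].
Proof.
have dim_polyE psi :
    module_dim_poly pi psi <-> group_dim_poly (group_of K) psi.
  split=> -[size_psi [i0 psiE]]; split=> //; exists i0 => i /psiE[d dimd dE];
    by exists d => //; apply/(has_dim_iff_krull_dim pi i d).
split=> [psi phi /dim_polyE dim_psi dim_phi|//|e|d|e].
- apply: dim_poly_unique dim_psi dim_phi => i d d'.
  exact: krull_dim_unique.
- by split=> -[psi /dim_polyE]; exists psi.
- by split=> -[psi /dim_polyE]; exists psi.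
- by split=> -[psi /dim_polyE]; exists psi.
Qed.
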